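(* Let $d\ge 1$ and let $x\in\mathbb{R}^d$ be non-zero, and let $k=\lceil\|x\|_2\rceil$ be the upper integer part of $\|x\|_2$. Then $$\sup \mathbb{P}(X_1+\cdots+X_n=x)=\mathbb{P}(R_{k^2}=k),$$ where the supremum is taken over all $n\ge 1$ and all collections $X_1,\ldots,X_n$ of independent symmetric random variables in $\mathbb{R}^d$ with $\|X_i\|_2\le 1$ almost surely, and where $R_{m}$ denotes the sum of $m$ independent Rademacher random variables.
   Context: A random variable $X$ in $\mathbb{R}^d$ is symmetric if $X$ and $-X$ have the same distribution. A Rademacher random variable $\varepsilon$ satisfies $\mathbb{P}(\varepsilon=1)=\mathbb{P}(\varepsilon=-1)=\tfrac12$. *)

(* Defs.v *)
From HB Require Import structures.
From mathcomp Require Import all_boot all_order all_algebra.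
From mathcomp Require Import all_classical all_reals all_analysis.
Set Implicit Arguments. Unset Strict Implicit. Unset Printing Implicit Defensive.
Import Order.TTheory GRing.Theory Num.Theory.
Local Open Scope classical_set_scope.
Local Open Scope ring_scope.

Definition eucl_norm (R : realType) (d : nat) (v : 'rV[R]_d) : R :=
  Num.sqrt (\sum_(j < d) v ord0 j ^+ 2).

(* Borel sigma-algebra of R^d = product sigma-algebra, generated by the
   coordinate cylinders {v | v_j \in B}, B Borel in R. *)
Definition borelRd (R : realType) (d : nat) : set (set 'rV[R]_d) :=
  <<s [set A | exists (j : 'I_d) (B : set R),
                 measurable B /\ A = (fun v : 'rV[R]_d => v ord0 j) @^-1` B] >>.

Definition rv_Rd (R : realType) (dT : measure_display) (T : measurableType dT)
  (d : nat) (X : T -> 'rV[R]_d) : Prop :=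
  forall B, borelRd B -> measurable (X @^-1` B).

(* Mutual independence of X_0, ..., X_{n-1} : the events {X_i \in B_i}
   satisfy the product rule (subfamilies are covered by taking B_i = R^d). *)
Definition independent_Rd (R : realType) (dT : measure_display)
  (T : measurableType dT) (P : probability T R) (d n : nat)
  (X : 'I_n -> T -> 'rV[R]_d) : Prop :=
  forall B : 'I_n -> set 'rV[R]_d, (forall i, borelRd (B i)) ->
    P (\bigcap_(i in [set: 'I_n]) (X i @^-1` B i)) =
    (\prod_(i < n) P (X i @^-1` B i))%E.

Definition symmetric_Rd (R : realType) (dT : measure_display)
  (T : measurableType dT) (P : probability T R) (d : nat)
  (X : T -> 'rV[R]_d) : Prop :=
  forall B, borelRd B -> P (X @^-1` B) = P ((fun w => - X w) @^-1` B).

(* P(R_m = k) where R_m is a sum of m independent Rademacher variables: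
   the law of (eps_1,...,eps_m) is uniform on {-1,1}^m. *)
Definition rademacher_sum_prob (R : realType) (m : nat) (k : int) : R :=
  (#|[set s : {ffun 'I_m -> bool} |
       \sum_(i < m) (if s i then 1 else -1 : int) == k]|%:R) / (2 ^+ m).

Definition attainable_probs (R : realType) (d : nat) (x : 'rV[R]_d) : set (\bar R) :=
  [set p | exists (n : nat) (dT : measure_display) (T : measurableType dT)
             (P : probability T R) (X : 'I_n -> T -> 'rV[R]_d),
     [/\ (1 <= n)%N, (forall i, rv_Rd (X i)), independent_Rd P X,
         (forall i, symmetric_Rd P (X i)) &
         (forall i, {ae P, forall w, eucl_norm (X i w) <= 1})] /\
     p = P [set w | \sum_(i < n) X i w = x]].

(* Main.v *)
(* Projecting on the line spanned by x reduces the upper bound to real symmetric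
   variables Y_i with |Y_i| <= 1 and to the point t = |x|, k - 1 < t <= k. As
   the joint law is invariant under sign changes, P (sum Y_i = t) is the average
   of P (sum e_i Y_i = t) over all signs e, hence at most the largest proportion
   of signs e with sum e_i a_i = t for fixed weights |a_i| <= 1.

   After dropping the zero weights and taking absolute values, this proportion
   is at most P (R_n = k) or P (R_n = k + 1), whichever parity allows. This is
   Milner's bound for k-intersecting antichains, obtained here from the linear
   structure: a Kleitman-type induction on the number of weights, for targets
   made of several well separated points, which lowers k until the symmetry of
   sum e_i a_i and the Erdos-Littlewood-Offord bound apply. Finally
   n |-> P (R_n = k) is unimodal with its maximum at n = k^2.

   Equality holds for k^2 independent variables uniform on {x / k, - x / k}. *)

Require Import Defs.
From HB Require Import structures.
From mathcomp Require Import all_boot all_order all_algebra.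
From mathcomp Require Import all_classical all_reals all_analysis.
From mathcomp Require Import measurable_realfun zify lra.
Set Implicit Arguments. Unset Strict Implicit. Unset Printing Implicit Defensive.
Import Order.TTheory GRing.Theory Num.Theory numFieldNormedType.Exports.
Local Open Scope classical_set_scope.
Local Open Scope ring_scope.

(** * Counting the signs with a prescribed signed sum *)

(** Conditions on the first sign, so that inductions on the weights compute; [card_sign_count]
    identifies it with a number of sign vectors. *)
Fixpoint sign_count (V : zmodType) (s : seq V) (t : V) : nat :=
  if s is a :: s' then (sign_count s' (t - a) + sign_count s' (t + a))%N
  else (t == 0).

Lemma sign_count_cons (V : zmodType) (a : V) s t :
  sign_count (a :: s) t = (sign_count s (t - a) + sign_count s (t + a))%N.
Proof. by []. Qed.

Lemma sign_count_opp (V : zmodType) (s : seq V) t :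
  sign_count s (- t) = sign_count s t.
Proof.
elim: s t => [|a s IH] t /=; first by rewrite oppr_eq0.
by rewrite -opprD [- t + a]addrC -opprB !IH addnC.
Qed.

(** The order of the weights is irrelevant, so an induction may split off any weight it chooses. *)
Lemma sign_count_rem (V : zmodType) (s : seq V) a t :
  a \in s -> sign_count s t = sign_count (a :: rem a s) t.
Proof.
elim: s t => // b s IH t; rewrite inE /=.
case: (eqVneq b a) => [-> //|nab /=].
move=> /IH {}IH; rewrite !IH /= addnACA.
by do 2!congr addn; rewrite addrAC.
Qed.

Lemma card_sign_count (V : zmodType) n (a : 'I_n -> V) (t : V) :
  #|[pred e : {ffun 'I_n -> bool} | \sum_i (if e i then a i else - a i) == t]|
  = sign_count [seq a i | i <- enum 'I_n] t.
Proof.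
elim: n a t => [|n IH] a t.
  rewrite enum_ord0 /= -sum1_card big_mkcond /=.
  rewrite (eq_bigr (fun=> (t == 0 : nat))) => [|e _].
    by rewrite sum_nat_const card_ffun card_ord expn0 mul1n.
  by rewrite inE big_ord0 eq_sym; case: eqP.
rewrite enum_ordSl map_cons sign_count_cons -map_comp -(IH (a \o lift ord0)) -IH.
(* Bijection from pairs (first sign, remaining signs) to sign vectors of length n + 1. *)
pose cons_ffun (p : bool * {ffun 'I_n -> bool}) :=
  [ffun i => if unlift ord0 i is Some j then p.2 j else p.1].
rewrite -!sum1_card (reindex cons_ffun) /=; last first.
  exists (fun e => (e ord0, [ffun i => e (lift ord0 i)])) => [[b e]|e] _.
    rewrite /cons_ffun; congr pair; first by rewrite ffunE unlift_none.
    by apply/ffunP => i; rewrite !ffunE liftK.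
  apply/ffunP => i; rewrite !ffunE; case: unliftP => [j|] -> //=.
  by rewrite ffunE.
pose hit (b : bool) (e : {ffun 'I_n -> bool}) :=
  \sum_i (if e i then a (lift ord0 i) else - a (lift ord0 i)) ==
    t - (if b then a ord0 else - a ord0).
rewrite (eq_bigl (fun p => hit p.1 p.2)) => [|p].
  rewrite -(pair_big_dep xpredT hit (fun _ _ => 1%N)) /=.
  by rewrite big_bool /hit /= opprK.
rewrite /hit inE [RHS]eq_sym subr_eq eq_sym big_ord_recl ffunE unlift_none addrC.
by under eq_bigr do rewrite ffunE liftK.
Qed.

(** * The simple random walk *)

(** This is 2^n P (R_n = k). *)
Definition walk_count (n : nat) (k : int) : nat := sign_count (nseq n 1) k.

(** Counts the walks ending in {k, k + 2, ..., k + 2 (r - 1)}, the model for a target of r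
    points. *)
Definition walk_block (n : nat) (k : int) (r : nat) : nat :=
  (\sum_(i < r) walk_count n (k + (2 * i)%N%:Z))%N.

Lemma walk_countS n k :
  walk_count n.+1 k = (walk_count n (k - 1) + walk_count n (k + 1))%N.
Proof. by []. Qed.

Lemma walk_count_opp n k : walk_count n (- k) = walk_count n k.
Proof. exact: sign_count_opp. Qed.

(** Translate the block by -1 and by +1, then hand the last point of the upper translate to the
    lower one: sizes r + 1 and r + 1 become r + 2 and r. Kleitman's regrouping of targets follows
    the same pattern. *)
Lemma walk_blockS n k r :
  walk_block n.+1 k r.+1 =
  (walk_block n (k - 1) r.+2 + walk_block n (k + 1) r)%N.
Proof.
rewrite /walk_block; under eq_bigr do rewrite walk_countS.
rewrite big_split /= [X in (_ + X)%N]big_ord_recr /=.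
rewrite [in RHS]big_ord_recr /= -!addnA; congr addn.
  by apply: eq_bigr => i _; congr walk_count; lia.
rewrite addnC; congr addn; first by congr walk_count; lia.
by apply: eq_bigr => i _; congr walk_count; lia.
Qed.

(** The block is {1 - 2r, ..., 2r - 1}, symmetric about 0, and [walk_block n 1 r] is its positive
    half. *)
Lemma walk_block_sym n r :
  walk_block n (1 - (r + r)%N%:Z) (r + r) = (walk_block n 1 r).*2.
Proof.
rewrite /walk_block big_split_ord /= -addnn; congr addn; last first.
  by apply: eq_bigr => i _; congr walk_count; rewrite /=; lia.
rewrite (reindex_inj rev_ord_inj); apply: eq_bigr => i _ /=.
rewrite -[in RHS]walk_count_opp; congr walk_count.
by have := ltn_ord i; lia.
Qed.

Lemma walk_block_leq n k r r' :
  (r <= r')%N -> (walk_block n k r <= walk_block n k r')%N.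
Proof.
move=> /subnKC <-; rewrite /walk_block big_split_ord /=.
exact: leq_addr.
Qed.

(* Kleitman's regrouping of the translates [T - a] and [T + a]. *)
Lemma sum_sign_count_cons (V : zmodType) (a : V) s t T :
  (\sum_(u <- t :: T) sign_count (a :: s) u =
   \sum_(u <- (t - a)%R :: [seq (v + a)%R | v <- t :: T]) sign_count s u +
   \sum_(u <- [seq (v - a)%R | v <- T]) sign_count s u)%N.
Proof.
rewrite [in RHS]big_cons !big_map big_split /= [X in (X + _)%N = _]big_cons.
by rewrite -!addnA; congr addn; rewrite addnC.
Qed.

(** * Concentration of signed sums *)

Section Concentration.
Variable R : realDomainType.
Implicit Types (a t : R) (s T : seq R).

(** Erdos-Littlewood-Offord bound for several targets. The comparison block is centred at 0, and the
    parity hypothesis puts it on the parity of the walk. If t is least in T, then t - a lies outside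
    T + a, so both regrouped targets stay duplicate-free. *)
Lemma sum_sign_count_uniq s T :
  all (fun a => 0 < a) s -> uniq T -> odd (size T + size s) ->
  (\sum_(t <- T) sign_count s t <=
   walk_block (size s) (1 - (size T)%:Z) (size T))%N.
Proof.
elim: s T => [|a s IH] T.
  move=> _ uT; rewrite addn0 => oT.
  have -> : (\sum_(t <- T) sign_count [::] t = count_mem 0%R T)%N.
    by rewrite -sum1_count [RHS]big_mkcond /=; apply: eq_bigr => t _; case: eqP.
  rewrite count_uniq_mem //; apply: leq_trans (leq_b1 _) _.
  (* The middle index of the centred block, where the point is 0 because the size of T is odd. *)
  have lt : ((size T)./2 < size T)%N by lia.
  rewrite /walk_block (bigD1 (Ordinal lt)) //=.
  rewrite [walk_count _ _](_ : _ = 1%N) //.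
  rewrite /walk_count /=; case: eqP => //; lia.
move=> /= /andP[a0 s0] uT; rewrite addnS /=.
have -> : (\sum_(t <- T) sign_count (a :: s) t =
           \sum_(t <- sort <=%R T) sign_count (a :: s) t)%N.
  by apply: perm_big; rewrite perm_sym perm_sort.
rewrite -(size_sort <=%R T).
have : sorted <%R (sort <=%R T) by rewrite sort_lt_sorted.
case: {T uT}(sort _ T) => [|t T] srt odT; first by rewrite big_nil.
have uT : uniq (t :: T) by apply: lt_sorted_uniq.
rewrite sum_sign_count_cons walk_blockS; apply: leq_add.
  apply: leq_trans (IH _ s0 _ _) _.
  - rewrite cons_uniq map_inj_uniq ?uT ?andbT; last exact: addIr.
    apply/mapP => -[v vT E].
    have : t <= v.
      move: vT; rewrite inE => /predU1P[->//|vT].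
      by move: srt => /= /(order_path_min lt_trans)/allP/(_ _ vT)/ltW.
    by move: E; lra.
  - by rewrite /= size_map; move: odT => /=; lia.
  - by rewrite /= size_map /=; apply: eq_leq; congr walk_block; lia.
apply: leq_trans (IH _ s0 _ _) _.
- by rewrite map_inj_uniq; [case/andP: uT | exact: addIr].
- by rewrite size_map; move: odT => /=; lia.
- by rewrite size_map /=; apply: eq_leq; congr walk_block; lia.
Qed.

(** Apply the previous bound to the disjoint union of T and -T, whose count is twice that of T, and
    halve. *)
Lemma sum_sign_count_antisym s T :
  all (fun a => 0 < a) s -> uniq T -> (forall t, t \in T -> - t \notin T) ->
  odd (size s) ->
  (\sum_(t <- T) sign_count s t <= walk_block (size s) 1 (size T))%N.
Proof.
move=> s0 uT asT os; rewrite -leq_double -walk_block_sym -addnn.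
have -> : (\sum_(t <- T) sign_count s t + \sum_(t <- T) sign_count s t =
           \sum_(t <- T ++ map -%R T) sign_count s t)%N.
  rewrite big_cat big_map /=; congr addn.
  by apply: eq_bigr => t _; rewrite sign_count_opp.
have sz : size (T ++ map -%R T) = (size T + size T)%N by rewrite size_cat size_map.
rewrite -sz; apply: sum_sign_count_uniq => //; last by rewrite sz; lia.
rewrite cat_uniq uT map_inj_uniq ?uT; last exact: oppr_inj.
rewrite andbT; apply/hasPn => _ /mapP[t tT ->]; exact: asT.
Qed.

(** Parity: n terms equal to a or -a sum to [a *~ j] only if j and n have the same parity. *)
Lemma sign_count_nseq_odd a n (j : int) :
  0 < a -> odd (n + `|j|) -> sign_count (nseq n a) (a *~ j) = 0%N.
Proof.
move=> a0; elim: n j => [|n IH] j oj.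
  rewrite /= mulrz_eq0 (gt_eqF a0) orbF.
  by case: eqP oj => // ->.
rewrite sign_count_cons.
have -> : a *~ j - a = a *~ (j - 1) by rewrite mulrzBr.
have -> : a *~ j + a = a *~ (j + 1) by rewrite mulrzDr.
by rewrite !IH //; lia.
Qed.

Lemma seq_max s : s != [::] -> exists2 a, a \in s & {in s, forall b, b <= a}.
Proof.
case: s => // a s _; elim: s a => [|b s IH] a.
  by exists a => [|c]; rewrite inE // => /eqP->.
have [c cs mc] := IH b.
have [ac|/ltW ca] := leP a c.
  exists c => [|e]; first by rewrite inE cs orbT.
  by rewrite inE => /predU1P[->//|]; apply: mc.
exists a => [|e]; first by rewrite mem_head.
by rewrite inE => /predU1P[->//|/mc/le_trans]; apply.
Qed.

(* The k of the theorem is [k.+1] here.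
   The target [T] lies beyond [k M] with gaps at least [2 M]. Removing the
   largest weight [a] and lowering [M] to [a], Kleitman's regrouping keeps the
   gaps, moves one part of the target down to level [k - 1] and the other up to
   level [k + 1]. At [k = 0] the bound comes instead from
   [sum_sign_count_antisym], which needs an odd number of weights. When that
   number is even, a weight [a <> t] is removed first, [t] being the least
   target, so that [t - a <> 0]; if every weight equals [t], then the remaining
   odd number of weights cannot sum to [0]. *)
Lemma sum_sign_count_gap n s T (M : R) (k : nat) :
  size s = n -> 0 < M -> {in s, forall a, 0 < a <= M} ->
  sorted (fun x y => x + M *+ 2 <= y) T -> {in T, forall t, M *+ k < t} ->
  (\sum_(t <- T) sign_count s t <=
   walk_block n (k.+1 + odd (n + k.+1))%N%:Z (size T))%N.
Proof.
elim: n s T M k => [|n IH] s T M k.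
  move=> /size0nil -> M0 _ _ Tk; rewrite big1_seq // => t /andP[_ /Tk].
  by rewrite /=; case: eqP => // ->; rewrite ltNge mulrn_wge0 // ltW.
move=> sn M0 sM srt Tk.
case: T srt Tk => [|t T] srt Tk; first by rewrite big_nil.
have tr : transitive (fun x y => x + M *+ 2 <= y) by move=> y x z; lra.
have Tt : {in T, forall u, t + M *+ 2 <= u}.
  by apply/allP; apply: order_path_min tr srt.
have tk : M *+ k < t by apply: Tk; rewrite mem_head.
have srtT : sorted (fun x y => x + M *+ 2 <= y) T := path_sorted srt.
have pull a : a \in s -> (\sum_(u <- t :: T) sign_count s u =
   \sum_(u <- (t - a)%R :: [seq (v + a)%R | v <- t :: T]) sign_count (rem a s) u +
   \sum_(u <- [seq (v - a)%R | v <- T]) sign_count (rem a s) u)%N.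
  move=> aIs; rewrite -sum_sign_count_cons; apply: eq_bigr => u _.
  exact: sign_count_rem.
have szr a : a \in s -> size (rem a s) = n by move=> /size_rem ->; rewrite sn.
have ltT : {in T, forall u, t < u} by move=> u /Tt; lra.
have shift (a M' : R) S : M' <= M -> sorted (fun x y => x + M *+ 2 <= y) S ->
    sorted (fun x y => x + M' *+ 2 <= y) [seq v + a | v <- S].
  move=> M'M; rewrite sorted_map; apply: sub_sorted => x y /=; lra.
case: k Tk tk => [|k] Tk tk.
  have t0 : 0 < t by rewrite mulr0n in tk.
  have uT : uniq (t :: T).
    apply: lt_sorted_uniq; apply: sub_sorted srt => x y; lra.
  have s0 : all (fun a => 0 < a) s by apply/allP => a /sM/andP[].
  have [on|on] := boolP (odd n.+1).
    have -> : odd (n.+1 + 1) = false by rewrite addn1 oddS on.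
    rewrite addn0 -sn.
    apply: sum_sign_count_antisym => //; last by rewrite sn.
    move=> u /Tk; rewrite mulr0n => u0; apply/negP => /Tk; rewrite mulr0n; lra.
  have on1 : odd n by move: on => /=; rewrite negbK.
  have [a aIs H] : exists2 a, a \in s &
     (\sum_(u <- (t - a)%R :: [seq (v + a)%R | v <- t :: T]) sign_count (rem a s) u
       <= walk_block n 1 (size T).+2)%N.
    have r0 a : all (fun a => 0 < a) (rem a s).
      by apply/allP => b /mem_rem /(allP s0).
    have uTa a : uniq [seq v + a | v <- t :: T].
      by rewrite map_inj_uniq //; apply: addIr.
    have Ta a : 0 < a -> {in [seq v + a | v <- t :: T], forall u, t + a <= u}.
      move=> a0 u /mapP[v vT ->]; rewrite lerD2r.
      by move: vT; rewrite inE => /predU1P[->//|/ltT/ltW].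
    have [/hasP[a aIs /= nat]|/hasPn alt] := boolP (has (fun a => a != t) s).
      exists a => //; have a0 := allP s0 _ aIs.
      apply: leq_trans (sum_sign_count_antisym (r0 a) _ _ _) _.
      - rewrite cons_uniq uTa andbT; apply/negP => /(Ta _ a0); lra.
      - move=> u; rewrite !inE => /predU1P[->|/(Ta _ a0) ua].
          rewrite negb_or; apply/andP; split; first by apply/eqP; move/eqP: nat; lra.
          by apply/negP => /(Ta _ a0); lra.
        rewrite negb_or; apply/andP; split; first by apply/eqP; lra.
        by apply/negP => /(Ta _ a0); lra.
      - by rewrite szr.
      - by rewrite szr //= size_map.
    have ts : t \in s.
      have : head t s \in s by case: (s) sn => //= b s' _; rewrite mem_head.
      by move=> h; have /negPn/eqP <- := alt _ h.
    exists t => //; rewrite big_cons subrr.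
    have -> : sign_count (rem t s) 0 = 0%N.
      have /all_pred1P -> : all (pred1 t) (rem t s).
        by apply/allP => b /mem_rem /alt /negPn.
      rewrite szr //; have := @sign_count_nseq_odd t n 0 t0.
      by rewrite mulr0z; apply; rewrite absz0 addn0.
    rewrite add0n; apply: leq_trans (sum_sign_count_antisym (r0 t) _ _ _) _ => //.
    - by move=> u /(Ta _ t0) ut; apply/negP => /(Ta _ t0); lra.
    - by rewrite szr.
    - by rewrite szr //= size_map; apply: walk_block_leq.
  rewrite (pull a) // (_ : odd (n.+1 + 1) = true) ?walk_blockS; last first.
    by rewrite addn1 /= negbK.
  apply: leq_add => //.
  have /andP[a0 aM] := sM _ aIs.
  (* A point of T - a is at least t + 2 M - a > M, so level 1 applies; as n is odd, the parity shift
     makes the block start at 3. *)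
  apply: leq_trans (IH (rem a s) _ M 1%N (szr _ aIs) M0 _ _ _) _.
  - by move=> b /mem_rem /sM.
  - exact: shift.
  - by move=> _ /mapP[u /Tt ut ->]; lra.
  - by rewrite size_map; apply: eq_leq; congr walk_block; clear -on1; lia.
have [a aIs amax] : exists2 a, a \in s & {in s, forall b, b <= a}.
  by apply: seq_max; rewrite -size_eq0 sn.
have /andP[a0 aM] := sM _ aIs.
have tka : a *+ k.+1 < t by apply: le_lt_trans tk; rewrite lerMn2r.
have ra : {in rem a s, forall b, 0 < b <= a}.
  by move=> b /mem_rem bs; rewrite amax // andbT; case/andP: (sM _ bs).
rewrite (pull a) // walk_blockS; apply: leq_add.
  apply: leq_trans (IH (rem a s) _ a k (szr _ aIs) a0 ra _ _) _.
  (* The gap from t - a to t + a is exactly 2 a, which is why the gap parameter drops to [a]. *)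
  - by apply/andP; split; [lra | exact: (@shift a a (t :: T))].
  - move=> u; rewrite inE => /predU1P[->|/mapP[v vT ->]]; rewrite mulrS in tka.
      lra.
    suff: t <= v by lra.
    by move: vT; rewrite inE => /predU1P[->//|/ltT/ltW].
  - by rewrite /= size_map; apply: eq_leq; congr walk_block; clear; lia.
(* Targets beyond t gain 2 M >= 2 a over t and lose a, so they clear (k + 2) a. *)
apply: leq_trans (IH (rem a s) _ a k.+2 (szr _ aIs) a0 ra _ _) _.
- exact: shift.
- by move=> _ /mapP[u /Tt ut ->]; rewrite mulrS; lra.
- by rewrite size_map; apply: eq_leq; congr walk_block; clear; lia.
Qed.

End Concentration.

(** * Maximality of n = k^2 for P (R_n = k) *)

Lemma walk_count_gt n (k : int) : n%:Z < k -> walk_count n k = 0%N.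
Proof.
elim: n k => [|n IH] k nk; first by rewrite /walk_count /=; case: eqP nk => // ->.
by rewrite walk_countS !IH //; lia.
Qed.

Lemma walk_count_bin n i : walk_count n (n%:Z - (2 * i)%N%:Z) = 'C(n, i).
Proof.
elim: n i => [|n IH] i.
  by rewrite /walk_count /= bin0n; case: i => // i; case: eqP => //; lia.
rewrite walk_countS; case: i => [|i].
  rewrite [X in (_ + X)%N]walk_count_gt; last by lia.
  by rewrite addn0 -[RHS](bin0 n) -IH; congr walk_count; lia.
by rewrite binS -!IH; congr addn; congr walk_count; lia.
Qed.

(** Two absorption identities; this measures the growth of P (R_m = k) from m = k + 2i to m + 2. *)
Lemma bin_ratio k i :
  ('C(k + 2 * i.+1, i.+1) * (i.+1 * (k + i.+1)) =
   (k + 2 * i.+1) * (k + 2 * i).+1 * 'C(k + 2 * i, i))%N.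
Proof.
have E1 : (i.+1 * 'C(k + 2 * i.+1, i.+1) = (k + 2 * i.+1) * 'C((k + 2 * i).+1, i))%N.
  by rewrite -mul_bin_diag; congr muln; congr binomial; lia.
have E2 : ((k + i.+1) * 'C((k + 2 * i).+1, i) = (k + 2 * i).+1 * 'C(k + 2 * i, i))%N.
  by have := mul_bin_down (k + 2 * i).+1 i; rewrite succnK => ->; congr muln; lia.
by rewrite mulnA [X in (X * _)%N]mulnC E1 -mulnA [X in (_ * X)%N]mulnC E2 mulnA.
Qed.

(** With m = k + 2i, passing from m to m + 2 multiplies C(m, i) / 2^m by (m + 1)(m + 2) / ((m + 2)^2
    - k^2), which is at least 1 exactly when m + 2 <= k^2. *)
Lemma bin_central_max k i j : (k ^ 2 = k + 2 * j)%N ->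
  ('C(k + 2 * i, i) * 4 ^ j <= 'C(k + 2 * j, j) * 4 ^ i)%N.
Proof.
move=> kj; pose b i := 'C(k + 2 * i, i).
have up m : (m < j)%N -> (4 * b m <= b m.+1)%N.
  move=> mj; have := bin_ratio k m; rewrite -!/(b _).
  have : (4 * (m.+1 * (k + m.+1)) <= (k + 2 * m.+1) * (k + 2 * m).+1)%N by nia.
  move=> H E; rewrite -(@leq_pmul2r (m.+1 * (k + m.+1))); last by lia.
  by rewrite E mulnAC leq_mul2r H orbT.
have down m : (j <= m)%N -> (b m.+1 <= 4 * b m)%N.
  move=> jm; have := bin_ratio k m; rewrite -!/(b _).
  have : ((k + 2 * m.+1) * (k + 2 * m).+1 <= 4 * (m.+1 * (k + m.+1)))%N by nia.
  move=> H E; rewrite -(@leq_pmul2r (m.+1 * (k + m.+1))); last by lia.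
  by rewrite E [leqRHS]mulnAC leq_mul2r H orbT.
rewrite -!/(b _); have [/subnK ij|/ltnW/subnK ij] := leqP i j.
  move: (j - i)%N ij => d; elim: d i => [|d IH] i ij.
    by rewrite -ij add0n.
  have := IH i.+1; rewrite addnS -addSn => /(_ ij).
  have := up i; rewrite -ij addSn ltnS leq_addl => /(_ isT).
  by rewrite !expnS; nia.
move: (i - j)%N ij => d; elim: d i => [|d IH] i ij; first by rewrite -ij.
have := IH _ (erefl (d + j)%N); have := down (d + j)%N (leq_addl _ _).
by rewrite -ij addSn !expnS; nia.
Qed.

(** The range starts at -1 so that the induction closes: k = -1 is the symmetry, and for k >= 0 both
    k - 1 and k + 1 stay in range. *)
Lemma walk_count_decr n (k : int) :
  -1 <= k -> (walk_count n (k + 2) <= walk_count n k)%N.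
Proof.
elim: n k => [|n IH] k k1; first by rewrite /walk_count /=; case: eqP => //; lia.
have [->|k0] := eqVneq k (-1); first by rewrite -[X in (_ <= X)%N]walk_count_opp.
rewrite !walk_countS; apply: leq_add.
  have -> : k + 2 - 1 = k - 1 + 2 by lia.
  by apply: IH; lia.
have -> : k + 2 + 1 = k + 1 + 2 by lia.
by apply: IH; lia.
Qed.

Lemma walk_count_max n k : (0 < k)%N ->
  (walk_count n (k + odd (n + k))%N%:Z * 2 ^ (k ^ 2) <=
   walk_count (k ^ 2) k%:Z * 2 ^ n)%N.
Proof.
move=> k0; have ev m : ~~ odd (m + k) ->
    (walk_count m k%:Z * 2 ^ (k ^ 2) <= walk_count (k ^ 2) k%:Z * 2 ^ m)%N.
  move=> mk; have [mk'|km] := ltnP m k.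
    by rewrite walk_count_gt ?mul0n //; lia.
  have [i Ei] : exists i, m = (k + 2 * i)%N by exists (m - k)./2; lia.
  have [j Ej] : exists j, (k ^ 2 = k + 2 * j)%N.
    have o : ~~ odd (k ^ 2 - k) by rewrite oddB ?oddX /=; [case: odd | nia].
    by exists (k ^ 2 - k)./2; have : (k <= k ^ 2)%N; [nia | lia].
  have E p : walk_count (k + 2 * p) k = 'C(k + 2 * p, p).
    by rewrite -walk_count_bin; congr walk_count; lia.
  have X p : (2 ^ (k + 2 * p) = 2 ^ k * 4 ^ p)%N by rewrite expnD expnM.
  rewrite Ei Ej !E !X mulnCA [leqRHS]mulnCA leq_mul2l.
  by rewrite (@bin_central_max k i j Ej) orbT.
have [oddk|evenk] := boolP (odd (n + k)); last by rewrite addn0; apply: ev.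
case: n oddk => [|m] oddk; first by rewrite walk_count_gt ?mul0n //; lia.
(* In the other parity, P (R_{m+1} = k + 1) is the average of P (R_m = k) and P (R_m = k + 2), and
   the latter is the smaller. *)
rewrite walk_countS (expnS 2 m).
have -> : (k + true)%N%:Z - 1 = k%:Z by lia.
have -> : (k + true)%N%:Z + 1 = k%:Z + 2 by lia.
have := @walk_count_decr m k%:Z; have : -1 <= k%:Z by lia.
move=> -> /(_ isT) H; have := ev m.
have -> : ~~ odd (m + k) by move: oddk; rewrite addSn /=.
move=> /(_ isT) E; rewrite [leqRHS]mulnCA mul2n -addnn.
by apply: leq_trans (leq_add E E); rewrite -mulnDl leq_mul2r leq_add2l H orbT.
Qed.

(** * The bound for arbitrary weights in [-1, 1] *)

Lemma sign_count_norm (R : realDomainType) (s : seq R) t :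
  sign_count [seq `|a| | a <- s] t = sign_count s t.
Proof.
elim: s t => // a s IH t /=; rewrite !IH.
by case: (ler0P a) => // _; rewrite opprK addnC.
Qed.

(** The sign of a zero weight is free, so each one doubles the count. *)
Lemma sign_count_nonzero (V : zmodType) (s : seq V) t :
  sign_count s t =
  (2 ^ count_mem 0%R s * sign_count [seq a <- s | a != 0%R] t)%N.
Proof.
elim: s t => [|a s IH] t /=; first by rewrite mul1n.
case: eqVneq => [->|_] /=; last by rewrite !IH mulnDr.
by rewrite subr0 addr0 IH expnS addnn -mul2n mulnA.
Qed.

(** The gap bound with the single target t and M = 1. Zero weights give the same power of 2 on both
    sides; absolute values make the others positive. *)
Lemma sign_count_le_walk (R : realDomainType) (s : seq R) (t : R) (k : nat) :
  {in s, forall a, `|a| <= 1} -> (0 < k)%N -> k.-1%:R < t ->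
  (sign_count s t * 2 ^ (k ^ 2) <= walk_count (k ^ 2) k%:Z * 2 ^ size s)%N.
Proof.
move=> s1 k0 kt; set s' := [seq `|a| | a <- [seq a <- s | a != 0]].
have sz : size s = (count_mem 0%R s + size s')%N.
  by rewrite size_map size_filter -[LHS](count_predC (pred1 0)).
rewrite sign_count_nonzero -sign_count_norm -/s' sz expnD -mulnA.
rewrite [leqRHS]mulnCA leq_mul2l; apply/orP; right.
apply: leq_trans (walk_count_max _ k0); rewrite leq_mul2r; apply/orP; right.
have := @sum_sign_count_gap R _ s' [:: t] 1 k.-1 erefl.
rewrite big_seq1 prednK // /walk_block big_ord1 muln0 addr0; apply=> //.
  move=> b /mapP[a]; rewrite mem_filter => /andP[a0 /s1 a1] ->.
  by rewrite normr_gt0 a0.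
by move=> u; rewrite inE => /eqP ->.
Qed.

Lemma rademacher_sum_probE (R : realType) m k :
  rademacher_sum_prob R m k = (walk_count m k)%:R / 2 ^+ m.
Proof.
rewrite /rademacher_sum_prob /walk_count; congr (_%:R / _).
have -> : nseq m (1 : int) = [seq (fun=> 1) i | i <- enum 'I_m].
  have /all_pred1P -> : all (pred1 1) [seq (fun=> 1 : int) i | i <- enum 'I_m].
    by apply/allP => _ /mapP[i _ ->] /=.
  by rewrite size_map size_enum_ord.
rewrite -card_sign_count; apply: eq_card => e; rewrite [RHS]inE.
by apply/idP/idP => [/set_mem //|h]; exact: mem_set.
Qed.

(** * Symmetrization *)

Section Symmetrization.
Context (R : realType) (dT : measure_display) (T : measurableType dT).
Variable P : probability T R.

(** Dynkin's pi-lambda argument: the two laws agree on boxes, hence on the sigma-algebra generated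
    by boxes, which contains the event that the coordinates sum to t. *)
Lemma sum_law_unique n (Y Z : 'I_n -> T -> R) t :
  (forall i, measurable_fun setT (Y i)) ->
  (forall i, measurable_fun setT (Z i)) ->
  (forall B : 'I_n -> set R, (forall i, measurable (B i)) ->
     P (\bigcap_(i in [set: 'I_n]) (Y i @^-1` B i)) =
     P (\bigcap_(i in [set: 'I_n]) (Z i @^-1` B i))) ->
  P [set w | \sum_i Y i w = t] = P [set w | \sum_i Z i w = t].
Proof.
move=> mY mZ YZ.
pose G := [set A : set ('I_n -> R) | exists2 B : 'I_n -> set R,
  forall i, measurable (B i) &
  A = \bigcap_(i in [set: 'I_n]) ((fun v => v i) @^-1` B i)].
pose U : measurableType _ := g_sigma_algebraType G.
have mXG (X : 'I_n -> T -> R) : (forall i, measurable_fun setT (X i)) ->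
    measurable_fun setT ((fun w => X^~ w) : T -> U).
  move=> mX; apply: (@measurability _ _ T U setT _ G) => // _ [_ [B mB ->] <-].
  rewrite setTI.
  apply: fin_bigcap_measurable => // i _.
  by rewrite -[X in measurable X]setTI; apply: mX.
pose law (X : 'I_n -> T -> R) (A : set U) := P ((fun w => X^~ w) @^-1` A).
have mpre X A : (forall i, measurable_fun setT (X i)) -> measurable (A : set U) ->
    measurable ((fun w => X^~ w) @^-1` A : set T).
  by move=> mX mA; rewrite -[X in measurable X]setTI; apply: mXG.
suff H (A : set U) : <<s G >> A -> law Y A = law Z A.
  pose S := (fun v : U => \sum_i v i) @^-1` [set t].
  apply: (H S); rewrite -[<<s G >>]/(@measurable _ U) -[S]setTI.
  suff : measurable_fun setT (fun v : U => \sum_i v i) by apply.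
  apply: measurable_sum => i _ B mB; rewrite setTI.
  apply: sub_sigma_algebra; exists (fun j => if j == i then B else setT).
    by move=> j; case: ifP.
  apply/seteqP; split => v /= => [Bv j _|/(_ i I)]; last by rewrite eqxx.
  by case: eqP => // ->.
apply: (@dynkin_induction _ U G (fun A => law Y A = law Z A)).
- by [].
- move=> _ _ [B mB ->] [C mC ->]; exists (fun i => B i `&` C i).
    by move=> i; apply: measurableI.
  by rewrite -bigcapI.
- by [].
- by move=> _ [B mB ->]; exact: YZ.
- move=> S mS E.
  have C X : (forall i, measurable_fun setT (X i)) ->
      law X (~` S) = (1 - law X S)%E.
    by move=> mX; apply: (@probability_setC _ _ _ P); apply: mpre.
  by rewrite C // C // E.
- move=> F mF tF E.
  have C X : (forall i, measurable_fun setT (X i)) ->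
      law X (\bigcup_k F k) = (\sum_(k <oo) law X (F k))%E.
    move=> mX; rewrite /law preimage_bigcup.
    apply: measure_semi_bigcup.
    - by move=> k; apply: mpre.
    - by move=> i j _ _ [w [Fi Fj]]; apply: tF => //; exists (X^~ w).
    - by apply: bigcupT_measurable => k; apply: mpre.
  rewrite C // C //; apply: eq_eseriesr => k _; exact: E.
Qed.

(** Flipping Y_i replaces B_i by -B_i in a box; independence and symmetry keep the probability of
    the box. *)
Lemma sum_sign_law n (Y : 'I_n -> T -> R) (e : {ffun 'I_n -> bool}) t :
  (forall i, measurable_fun setT (Y i)) ->
  (forall B : 'I_n -> set R, (forall i, measurable (B i)) ->
     P (\bigcap_(i in [set: 'I_n]) (Y i @^-1` B i)) =
     (\prod_(i < n) P (Y i @^-1` B i))%E) ->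
  (forall i (B : set R), measurable B ->
     P (Y i @^-1` B) = P ((fun w => - Y i w) @^-1` B)) ->
  P [set w | \sum_i Y i w = t] =
  P [set w | \sum_i (if e i then Y i w else - Y i w) = t].
Proof.
move=> mY indY symY.
have mN (B : set R) : measurable B -> measurable (-%R @^-1` B).
  move=> mB; rewrite -[X in measurable X]setTI.
  exact: oppr_measurable.
apply: (sum_law_unique (Z := fun i w => if e i then Y i w else - Y i w)) => //.
  move=> i; case: (e i) => //; exact: measurableT_comp.
move=> B mB; pose B' i := if e i then B i else -%R @^-1` B i.
have -> : \bigcap_(i in [set: 'I_n])
    ((fun w => if e i then Y i w else - Y i w) @^-1` B i) =
    \bigcap_(i in [set: 'I_n]) (Y i @^-1` B' i).
  by apply: eq_bigcapr => i _; rewrite /B'; case: (e i).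
rewrite !indY //; last by move=> i; rewrite /B'; case: (e i) => //; apply: mN.
apply: eq_bigr => i _; rewrite /B'; case: (e i) => //.
exact: symY.
Qed.

(** Summing the equal probabilities over all 2^n signs gives the expected number of signs that hit
    t, which [sign_count_le_walk] bounds almost surely. *)
Lemma sum_prob_le n (Y : 'I_n -> T -> R) (t : R) (k : nat) :
  (forall i, measurable_fun setT (Y i)) ->
  (forall B : 'I_n -> set R, (forall i, measurable (B i)) ->
     P (\bigcap_(i in [set: 'I_n]) (Y i @^-1` B i)) =
     (\prod_(i < n) P (Y i @^-1` B i))%E) ->
  (forall i (B : set R), measurable B ->
     P (Y i @^-1` B) = P ((fun w => - Y i w) @^-1` B)) ->
  (forall i, {ae P, forall w, `|Y i w| <= 1}) ->
  (0 < k)%N -> k.-1%:R < t ->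
  (P [set w | (\sum_i Y i w = t)%R]%classic <=
   ((walk_count (k ^ 2) k%:Z)%:R / 2 ^+ (k ^ 2))%R%:E)%E.
Proof.
move=> mY indY symY bY k0 kt.
pose E (e : {ffun 'I_n -> bool}) :=
  [set w | \sum_i (if e i then Y i w else - Y i w) = t].
have mE e : measurable (E e).
  rewrite -[E e]setTI.
  suff mf : measurable_fun setT
      (fun w => \sum_i (if e i then Y i w else - Y i w)).
    exact: (mf measurableT [set t] (measurable_set1 t)).
  by apply: measurable_sum => i; case: (e i) => //; apply: measurableT_comp.
set p := P _; have mS : measurable [set w | \sum_i Y i w = t].
  rewrite -[X in measurable X]setTI.
  suff mf : measurable_fun setT (fun w => \sum_i Y i w).
    exact: (mf measurableT [set t] (measurable_set1 t)).
  exact: measurable_sum.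
have pfin : p \is a fin_num by apply: fin_num_measure.
(* The almost sure bound on that number: the extremal proportion times 2^n. *)
pose N : R := (walk_count (k ^ 2) k%:Z)%:R / 2 ^+ (k ^ 2) * 2 ^+ n.
have N0 : 0 <= N by rewrite !mulr_ge0 // ?invr_ge0 ?exprn_ge0.
have sumE : (\sum_(e : {ffun 'I_n -> bool}) P (E e) <= N%:E)%E.
  have -> : (\sum_(e : {ffun 'I_n -> bool}) P (E e) =
    \int[P]_w (\sum_(e : {ffun 'I_n -> bool}) (\1_(E e) w)%:E))%E.
    rewrite ge0_integral_sum //; last first.
      by move=> e; apply/measurable_EFinP; apply: measurable_indic.
    by apply: eq_bigr => e _; rewrite integral_indic // setIT.
  have <- : (\int[P]_w (cst N%:E w) = N%:E)%E.
    rewrite integral_cst // -[RHS]mule1; congr (_ * _)%E.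
    exact: probability_setT.
  apply: ae_ge0_le_integral => //.
  - by move=> w _; apply: sume_ge0.
  - by apply: emeasurable_sum => e; apply/measurable_EFinP; apply: measurable_indic.
  have : {ae P, forall w, forall i, `|Y i w| <= 1} by apply: filter_forall.
  apply: filterS => w Yw _.
  rewrite sumEFin lee_fin.
  have -> : \sum_(e : {ffun 'I_n -> bool}) \1_(E e) w =
      (sign_count [seq Y i w | i <- enum 'I_n] t)%:R :> R.
    rewrite -card_sign_count -sum1_card natr_sum [RHS]big_mkcond /=.
    apply: eq_bigr => e _; rewrite indicE inE /E.
    case: eqP => h; first by rewrite mem_set.
    by rewrite memNset.
  have := @sign_count_le_walk _ [seq Y i w | i <- enum 'I_n] t k _ k0 kt.
  rewrite size_map size_enum_ord => H.
  rewrite /N mulrAC ler_pdivlMr ?exprn_gt0 // -!natrX -!natrM ler_nat.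
  by apply: H => _ /mapP[i _ ->].
have : ((2 ^+ n)%:E * p <= N%:E)%E.
  apply: le_trans sumE; rewrite (eq_bigr (fun=> p)) => [|e _]; last first.
    by apply/esym/sum_sign_law.
  rewrite -(fineK pfin) sumEFin sumr_const card_ffun card_bool card_ord.
  by rewrite -EFinM lee_fin mulrC -natrX mulr_natr.
rewrite -(fineK pfin) -EFinM !lee_fin /N mulrC ler_pM2r //.
Qed.

End Symmetrization.

(** * The extremal example and the theorem *)

(** An alias to which the discrete sigma-algebra is attached, so that every map out of it is
    measurable. *)
Definition sign_space (n : nat) : Type := {ffun 'I_n -> bool}.

HB.instance Definition _ n := Finite.on (sign_space n).
HB.instance Definition _ n := isPointed.Build (sign_space n) [ffun=> true].
HB.instance Definition _ n :=
  @isMeasurable.Build default_measure_display (sign_space n)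
    discrete_measurable discrete_measurable0
    discrete_measurableC discrete_measurableU.

Section UniformSign.
Context (R : realType) (n : nat).

(** Built from Dirac masses by [msum] and [mscale], so that its measure structure is inferred;
    [point] is only the default value of [nth]. *)
Definition uniform_sign : set (sign_space n) -> \bar R :=
  mscale ((2 ^+ n)^-1)%:nng
    (msum (fun i => dirac (nth point (index_enum (sign_space n)) i))
       (size (index_enum (sign_space n)))).

HB.instance Definition _ := Measure.on uniform_sign.

Lemma uniform_signE (A : set (sign_space n)) :
  uniform_sign A = ((\sum_(e : sign_space n) \1_A e) / 2 ^+ n)%:E.
Proof.
rewrite /uniform_sign /mscale /= /msum /dirac sumEFin -EFinM mulrC.
congr (_ / _)%:E.
by rewrite [RHS](big_nth point) big_mkord.
Qed.

Lemma uniform_sign_setT : uniform_sign [set: sign_space n] = 1%E.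
Proof.
rewrite uniform_signE (eq_bigr (fun=> 1)) => [|e _]; last by rewrite indicT.
rewrite sumr_const card_ffun card_bool card_ord natrX divff //.
Qed.

HB.instance Definition _ :=
  @Measure_isProbability.Build _ _ R uniform_sign uniform_sign_setT.

Variables (d : nat) (v : 'rV[R]_d).

Definition sign_vec (i : 'I_n) (e : sign_space n) : 'rV[R]_d :=
  if e i then v else - v.

(** Expanding the product of two-term sums yields one term per sign vector. *)
Lemma uniform_sign_box (B : 'I_n -> set 'rV[R]_d) :
  uniform_sign (\bigcap_(i in [set: 'I_n]) (sign_vec i @^-1` B i)) =
  (\prod_(i < n) ((\1_(B i) v + \1_(B i) (- v)) / 2))%:E.
Proof.
rewrite uniform_signE big_split /= prodr_const card_ord exprVn.
congr (_ / _)%:E.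
pose F i (b : bool) : R := \1_(B i) (if b then v else - v).
transitivity (\prod_(i < n) \sum_b F i b); last first.
  by apply: eq_bigr => i _; rewrite big_bool.
rewrite bigA_distr_bigA /=; apply: eq_bigr => e _.
rewrite indicE; have [/set_mem eB|neB] := boolP (e \in _).
  by rewrite big1 // => i _; rewrite /F indicE mem_set //; exact: eB.
have [i Bi] : exists i, ~ B i (sign_vec i e).
  apply/not_existsP => h; move/negP: neB; apply; apply: mem_set => i _.
  by apply: contrapT; exact: h.
by rewrite (bigD1 i) //= /F indicE memNset ?mul0r.
Qed.

Lemma uniform_sign_coord i (B : set 'rV[R]_d) :
  uniform_sign (sign_vec i @^-1` B) = ((\1_B v + \1_B (- v)) / 2)%:E.
Proof.
pose B' j := if j == i then B else setT.
have -> : sign_vec i @^-1` B =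
    \bigcap_(j in [set: 'I_n]) (sign_vec j @^-1` B' j).
  apply/seteqP; split => e /= => [Be j _|/(_ i I)]; rewrite /B' ?eqxx //.
  by case: eqP => // ->.
rewrite uniform_sign_box (bigD1 i) //= /B' eqxx big1 ?mulr1 // => j /negbTE ->.
by rewrite !indicT /= divff.
Qed.

End UniformSign.

Lemma eucl_normZ (R : realType) d (a : R) (v : 'rV[R]_d) :
  eucl_norm (a *: v) = `|a| * eucl_norm v.
Proof.
rewrite /eucl_norm -sqrtr_sqr -sqrtrM ?sqr_ge0 // mulr_sumr.
by congr Num.sqrt; apply: eq_bigr => j _; rewrite mxE exprMn.
Qed.

Lemma eucl_norm_gt0 (R : realType) d (v : 'rV[R]_d) :
  v != 0 -> 0 < eucl_norm v.
Proof.
move=> v0; rewrite sqrtr_gt0 lt_neqAle sumr_ge0 ?andbT; last first.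
  by move=> j _; apply: sqr_ge0.
apply: contra v0 => /eqP/esym h; apply/eqP/rowP => j; rewrite mxE.
apply/eqP; rewrite -sqrf_eq0; apply/eqP.
by apply: (psumr_eq0P _ h) => // i _; apply: sqr_ge0.
Qed.

Lemma attainable_rademacher (R : realType) d (x : 'rV[R]_d) (k : nat) :
  (0 < k)%N -> x != 0 -> eucl_norm x <= k%:R ->
  attainable_probs x (rademacher_sum_prob R (k ^ 2) k%:Z)%:E.
Proof.
move=> k0 x0 xk; pose n := (k ^ 2)%N; pose v := k%:R^-1 *: x.
have kR : 0 < k%:R :> R by rewrite ltr0n.
have v1 : eucl_norm v <= 1.
  by rewrite eucl_normZ ger0_norm ?invr_ge0 // mulrC ler_pdivrMr // mul1r.
exists n, default_measure_display, (sign_space n), (@uniform_sign R n).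
exists (@sign_vec R n d v); split; first split.
- by rewrite expn_gt0 k0.
- by move=> i B _.
- move=> B _; rewrite [LHS]uniform_sign_box -prodEFin.
  by apply: eq_bigr => i _; rewrite [RHS]uniform_sign_coord.
- move=> i B _; rewrite [LHS]uniform_sign_coord.
  rewrite [RHS](@uniform_sign_coord R n d v i (-%R @^-1` B)) addrC.
  congr ((_ + _) / _)%:E; rewrite !indicE; congr (nat_of_bool _)%:R;
    by apply/idP/idP => /set_mem h; apply: mem_set; move: h => /=; rewrite ?opprK.
- move=> i; apply: aeW => e; rewrite /sign_vec; case: (e i) => //.
  by rewrite -scaleN1r eucl_normZ normrN1 mul1r.
rewrite [RHS]uniform_signE /rademacher_sum_prob; congr (_ / _)%:E.
rewrite -sum1_card natr_sum big_mkcond; apply: eq_bigr => e _.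
rewrite indicE; pose z : int := \sum_(i < n) (if e i then 1 else -1 : int).
(* The sum is a multiple of x with factor z / k; as x is non-zero, it hits x exactly when z = k. *)
have S : \sum_(i < n) sign_vec v i e = (z%:~R / k%:R) *: x.
  rewrite -scalerA -/v /z rmorph_sum scaler_suml; apply: eq_bigr => i _.
  by rewrite /sign_vec; case: (e i); rewrite ?scale1r // rmorphN scaleN1r.
have -> : (e \in [set w | \sum_(i < n) sign_vec v i w = x]) = (z == k%:Z).
  apply/idP/eqP => [/set_mem /=|zk]; last first.
    by apply: mem_set; rewrite /= S zk divff ?scale1r ?gt_eqF.
  rewrite S => /eqP; rewrite -subr_eq0 -{2}[x]scale1r -scalerBl scaler_eq0.
  rewrite (negbTE x0) orbF subr_eq0 => /eqP/(canRL (mulfVK (lt0r_neq0 kR))).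
  by rewrite mul1r -[k%:R]/(k%:~R) => /intr_inj.
have -> : (e \in [set s : {ffun 'I_n -> bool} |
    \sum_(i < n) (if s i then 1 else -1 : int) == k%:Z]) = (z == k%:Z).
  by apply/idP/idP => [/set_mem|h]; [|apply: mem_set].
by case: eqP.
Qed.

(** * The upper bound by projection on the line of x *)

(** A linear form is a finite combination of coordinates. Through such preimages the projections
    inherit measurability, independence and symmetry. *)
Lemma borelRd_dot (R : realType) d (u : 'I_d -> R) (B : set R) :
  measurable B -> borelRd ((fun v => \sum_j v ord0 j * u j) @^-1` B).
Proof.
move=> mB; pose G := [set A | exists (j : 'I_d) (B : set R),
  measurable B /\ A = (fun v : 'rV[R]_d => v ord0 j) @^-1` B].
pose U : measurableType _ := g_sigma_algebraType G.
have mf : measurable_fun setT (fun v : U => \sum_j v ord0 j * u j).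
  apply: measurable_sum => j; apply: measurable_funM => // _ C mC.
  by rewrite setTI; apply: sub_sigma_algebra; exists j, C.
by have := mf measurableT B mB; rewrite setTI.
Qed.

Lemma attainable_le_rademacher (R : realType) d (x : 'rV[R]_d) (k : nat) p :
  (0 < k)%N -> x != 0 -> k.-1%:R < eucl_norm x ->
  attainable_probs x p -> (p <= (rademacher_sum_prob R (k ^ 2) k%:Z)%:E)%E.
Proof.
move=> k0 x0 kx [n [dT [T [P [X [[_ mX indX symX bX] ->]]]]]].
have nx0 := eucl_norm_gt0 x0.
have nx2 : \sum_j x ord0 j ^+ 2 = eucl_norm x ^+ 2.
  by rewrite sqr_sqrtr // sumr_ge0 // => j _; apply: sqr_ge0.
(* The unit vector along x, so that [f] sends x to its norm and the unit ball into [-1, 1]. *)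
pose u j := x ord0 j / eucl_norm x.
pose f (v : 'rV[R]_d) := \sum_j v ord0 j * u j.
have u1 : \sum_j u j ^+ 2 = 1.
  rewrite /u; under eq_bigr do rewrite exprMn exprVn.
  by rewrite -mulr_suml nx2 divff // expf_neq0 // gt_eqF.
have mf (B : set R) : measurable B -> borelRd (f @^-1` B) := @borelRd_dot R d u B.
have fN v : f (- v) = - f v.
  by rewrite /f -sumrN; apply: eq_bigr => j _; rewrite mxE mulNr.
have f1 v : eucl_norm v <= 1 -> `|f v| <= 1.
  move=> v1; have {}v1 : \sum_j v ord0 j ^+ 2 <= 1.
    have := v1; rewrite -(@ler_pXn2r _ 2) ?nnegrE ?sqrtr_ge0 // expr1n.
    by rewrite sqr_sqrtr // sumr_ge0 // => j _; apply: sqr_ge0.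
  (* AM-GM termwise replaces Cauchy-Schwarz, both vectors being in the unit ball *)
  have : `|f v| <= \sum_j (v ord0 j ^+ 2 + u j ^+ 2) / 2.
    apply: le_trans (ler_norm_sum _ _ _) _; apply: ler_sum => j _.
    have := sqr_ge0 (v ord0 j - u j); have := sqr_ge0 (v ord0 j + u j).
    by rewrite ler_norml !sqrrD sqrrN mulrN => h1 h2; apply/andP; split; lra.
  rewrite -mulr_suml big_split /= u1; lra.
have fx (w : T) : \sum_i X i w = x -> \sum_i f (X i w) = eucl_norm x.
  move=> Sx; rewrite /f exchange_big /=.
  rewrite (eq_bigr (fun j => x ord0 j ^+ 2 / eucl_norm x)).
    by rewrite -mulr_suml nx2 expr2 mulfK // gt_eqF.
  by move=> j _; rewrite -mulr_suml -summxE Sx /u expr2 mulrA.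
have mY i : measurable_fun setT (fun w => f (X i w)).
  by move=> _ B mB; rewrite setTI; apply: (mX i _ (mf B mB)).
rewrite rademacher_sum_probE.
apply: le_trans (@sum_prob_le _ _ _ P _ (fun i w => f (X i w)) _ _
  _ _ _ _ k0 kx) => //.
(* An inclusion of events suffices: if the X_i sum to x, their projections sum to the norm of x. *)
- apply: le_measure; rewrite ?inE.
  + have -> : [set w | \sum_i X i w = x] = \bigcap_(j in [set: 'I_d])
        ((fun w => \sum_i X i w ord0 j) @^-1` [set x ord0 j]).
      apply/seteqP; split => w /= => [<- j _|h]; first by rewrite /= summxE.
      by apply/rowP => j; rewrite summxE; apply: h.
    apply: fin_bigcap_measurable => // j _; rewrite -[X in measurable X]setTI.
    have mS : measurable_fun setT (fun w => \sum_i X i w ord0 j).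
      apply: measurable_sum => i _ B mB; rewrite setTI.
      apply: (mX i ((fun v : 'rV[R]_d => v ord0 j) @^-1` B)).
      by apply: sub_sigma_algebra; exists j, B.
    exact: (mS measurableT _ (measurable_set1 _)).
  + rewrite -[X in measurable X]setTI.
    have mS : measurable_fun setT (fun w => \sum_i f (X i w)).
      exact: measurable_sum.
    exact: (mS measurableT _ (measurable_set1 _)).
  + by move=> w /= /fx.
- by move=> B mB; apply: (indX (fun i => f @^-1` B i)) => i; apply: mf.
- move=> i B mB; have := symX i _ (mf B mB).
  by congr (_ = P _); apply/seteqP; split => w /=; rewrite fN.
- by move=> i; apply: filterS (bX i) => w; apply: f1.
Qed.

Theorem theorem3 (R : realType) (d : nat) (x : 'rV[R]_d) :
  (1 <= d)%N -> x != 0 ->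
  let k : int := Num.ceil (eucl_norm x) in
  ereal_sup (attainable_probs x) =
    (rademacher_sum_prob R (`|k| ^ 2)%N k)%:E.
Proof.
move=> _ x0 k; have nx0 := eucl_norm_gt0 x0.
have k0 : 0 < k by rewrite /k ceil_gt0.
have Ek : k = `|k|%N by rewrite gez0_abs // ltW.
have K0 : (0 < `|k|)%N by rewrite absz_gt0 gt_eqF.
rewrite [X in rademacher_sum_prob _ _ X]Ek.
apply/eqP; rewrite eq_le; apply/andP; split.
  apply: ge_ereal_sup => p; apply: attainable_le_rademacher => //.
  (* The ceiling gives k - 1 < |x|, and since k > 0 the natural predecessor [k.-1] is k - 1. *)
  have := ceilB1_lt (eucl_norm x); rewrite -/k Ek.
  by rewrite -[X in (X%:Z - 1)](prednK K0) -addn1 PoszD addrK.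
apply: ereal_sup_ubound; apply: attainable_rademacher => //.
by have := ceil_ge (eucl_norm x); rewrite -/k {1}Ek.
Qed.
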